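(* Let $G$ be a connected graph on $n$ vertices and let $k$ be a natural number with $2\le k\le n$. Then $$\overline{B_k}(G)=\frac{\binom{n}{k}}{n}\left(\overline{SW_k}(G)-k+1\right).$$
   Context: All graphs are finite, simple and undirected. For a connected graph $G$ and $S\subseteq V(G)$, the Steiner diversity $\delta(S)$ is the minimum number of edges of a connected subgraph of $G$ whose vertex set contains $S$. A connected subgraph of $G$ whose vertex set contains $S$ and which has exactly $\delta(S)$ edges is a tree, called a Steiner tree on $S$. The vertices in $S$ are its terminal vertices; its other vertices are its non-terminal vertices. For a natural number $k\ge 2$ the Steiner $k$-Wiener index of $G$ is $SW_k(G)=\sum_{S\subseteq V(G),\,|S|=k}\delta(S)$, and the average $k$-Steiner diversity of a graph $G$ on $n$ vertices is $\overline{SW_k}(G)=SW_k(G)/\binom{n}{k}$. The $k$-Steiner betweenness centrality of a vertex $v\in V(G)$ is $$B_k(v)=\sum_{\substack{A\subseteq V(G)\setminus\{v\}\\ |A|=k}}\frac{\sigma_A(v)}{\sigma_A},$$ where $\sigma_A$ is the number of all Steiner trees on $A$ in $G$ and $\sigma_A(v)$ is the number of all Steiner trees on $A$ in $G$ that include $v$ as a non-terminal vertex. The average $k$-Steiner betweenness of a graph $G$ on $n$ vertices is $\overline{B_k}(G)=\frac1n\sum_{v\in V(G)}B_k(v)$. *)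

(* Defs.v *)
From mathcomp Require Import all_boot all_order all_algebra.
Set Implicit Arguments.
Unset Strict Implicit.
Unset Printing Implicit Defensive.
Import GRing.Theory Num.Theory.

(* A finite simple graph is a symmetric irreflexive relation
   e on a finType T; symmetry and irreflexivity are hypotheses wherever they
   matter, not part of the definitions. *)

Definition connected_graph (T : finType) (e : rel T) : Prop :=
  forall x y : T, connect e x y.

Definition edges (T : finType) (e : rel T) : {set {set T}} :=
  [set [set p.1; p.2] | p : T * T & e p.1 p.2].

(* A candidate subgraph is a pair (vertex set, edge set), each edge being the
   set of its two ends; distinct subgraphs are distinct pairs. *)
Notation pregraph T := ({set T} * {set {set T}})%type.

Definition is_subgraph (T : finType) (e : rel T) (H : pregraph T) : bool :=
  (H.2 \subset edges e) && [forall f in H.2, f \subset H.1].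

Definition connected_pregraph (T : finType) (H : pregraph T) : bool :=
  [forall x in H.1, forall y in H.1,
     connect (fun u v : T => [set u; v] \in H.2) x y].

Definition connects (T : finType) (e : rel T) (S : {set T}) (H : pregraph T) :
    bool :=
  [&& is_subgraph e H, connected_pregraph H & S \subset H.1].

(* The default of the arg min is G itself, which is a legitimate candidate
   whenever G is connected; so the minimum is then a genuine one. *)
Definition steiner_div (T : finType) (e : rel T) (S : {set T}) : nat :=
  #|[arg min_(H < ([set: T], edges e) | connects e S H) #|H.2| ].2|.

Definition steiner_trees (T : finType) (e : rel T) (S : {set T}) :
    {set pregraph T} :=
  [set H : pregraph T | connects e S H & #|H.2| == steiner_div e S].

Definition steiner_trees_through (T : finType) (e : rel T) (S : {set T})
    (v : T) : {set pregraph T} :=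
  [set H in steiner_trees e S | v \in H.1 :\: S].

Definition SW (T : finType) (e : rel T) (k : nat) : nat :=
  \sum_(S : {set T} | #|S| == k) steiner_div e S.

Local Open Scope ring_scope.

Definition avgSW (T : finType) (e : rel T) (k : nat) : rat :=
  (SW e k)%:R / 'C(#|T|, k)%:R.

Definition steiner_betweenness (T : finType) (e : rel T) (k : nat) (v : T) :
    rat :=
  \sum_(A : {set T} | (A \subset [set~ v]) && (#|A| == k))
    #|steiner_trees_through e A v|%:R / #|steiner_trees e A|%:R.

Definition avgB (T : finType) (e : rel T) (k : nat) : rat :=
  #|T|%:R^-1 * \sum_(v : T) steiner_betweenness e k v.

(* Main.v *)
Require Import Defs.
From mathcomp Require Import all_boot all_order all_algebra.
Set Implicit Arguments.
Unset Strict Implicit.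
Unset Printing Implicit Defensive.
Import GRing.Theory Num.Theory.
Local Open Scope ring_scope.

(** Every connected graph with nonempty vertex set [V] has a connected spanning
    subgraph with [#|V| - 1] edges ([spanning_tree]). By minimality a Steiner
    tree on a nonempty set [S] is therefore a tree: it has exactly
    [steiner_div e S + 1] vertices ([card_steiner_tree]), of which
    [steiner_div e S + 1 - #|S|] are non-terminal. Counting in two ways the pairs
    formed by a Steiner tree on [S] and one of its non-terminal vertices gives
      [\sum_(v | v \notin S) sigma_S(v) / sigma_S = steiner_div e S + 1 - #|S|]
    ([sum_through_ratio]). Exchanging the sums over vertices and over [k]-sets in
    the total betweenness, and summing this identity over all [k]-sets, yields
    [SW e k - (k - 1) * 'C(n, k)], which is the claim up to normalisation. *)

Section SpanningTree.
Variable T : finType.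
Implicit Types (W : {set T}) (F : {set {set T}}).

Lemma connect_leaves (r : rel T) W x y :
  connect r x y -> x \in W -> y \notin W ->
  exists u w, [/\ u \in W, w \notin W & r u w].
Proof.
case/connectP=> p; elim: p x => [|z p IHp] x /=.
  by move=> _ -> ->.
case/andP=> rxz pz y_last xW yW; have [zW|zW] := boolP (z \in W).
  exact: IHp pz y_last zW yW.
by exists x, z.
Qed.

Lemma connected_pregraph_add_leaf W F u w :
  u \in W -> connected_pregraph (W, F) ->
  connected_pregraph (w |: W, [set u; w] |: F).
Proof.
move=> uW /forall_inP /= conn.
set r' := fun a b : T => [set a; b] \in [set u; w] |: F.
have r'_sym : connect_sym r'.
  by apply: sym_connect_sym => a b; rewrite /r' setUC.
have to_u x : x \in w |: W -> connect r' x u.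
  rewrite in_setU1 => /orP[/eqP->|xW].
    by apply: connect1; rewrite /r' setUC setU11.
  have /forall_inP/(_ u uW) := conn x xW.
  by apply: connect_sub => a b Fab; apply: connect1; rewrite /r' setU1r.
apply/forall_inP => x /to_u xu; apply/forall_inP => y /to_u yu.
by apply: connect_trans xu _; rewrite r'_sym.
Qed.

(** Inside a connected graph there is a subtree on [m + 1] vertices for every
    [m + 1 <= #|V|]: grow it one edge at a time from a single vertex. *)
Lemma subtree_of_size (V : {set T}) (E : {set {set T}}) (m : nat) :
  connected_pregraph (V, E) -> {in E, forall f : {set T}, f \subset V} ->
  (m < #|V|)%N ->
  exists W F, [/\ W \subset V, F \subset E, connected_pregraph (W, F),
    {in F, forall f : {set T}, f \subset W} & #|W| = m.+1 /\ #|F| = m].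
Proof.
move=> connV EV; elim: m => [|m IHm] mV.
  have [x xV] := card_gt0P mV.
  exists [set x], set0; rewrite sub1set xV sub0set cards1 cards0.
  split=> //; last by move=> f; rewrite inE.
  by apply/forall_inP => y /set1P->; apply/forall_inP => z /set1P->.
have [W [F [WV FE connW FW [cardW cardF]]]] := IHm (ltnW mV).
have [x xW] : exists x, x \in W by apply/card_gt0P; rewrite cardW.
have /subsetPn[y yV yW] : ~~ (V \subset W).
  by apply: contraL mV => /subset_leq_card; rewrite cardW -leqNgt.
have /forall_inP/(_ x (subsetP WV x xW))/forall_inP/(_ y yV) /= xy := connV.
have [u [w [uW wW uwE]]] := connect_leaves xy xW yW.
have uwF : [set u; w] \notin F.
  by apply: contra wW => /FW/subsetP; apply; rewrite set22.
have wV : w \in V by apply: (subsetP (EV _ uwE)); rewrite set22.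
exists (w |: W), ([set u; w] |: F); split.
- by rewrite subUset sub1set wV.
- by rewrite subUset sub1set uwE.
- exact: connected_pregraph_add_leaf.
- move=> f /setU1P[->|/FW fW]; last exact: subset_trans fW (subsetUr _ _).
  by rewrite subUset !sub1set setU11 setU1r.
- by rewrite !cardsU1 wW uwF cardW cardF.
Qed.

Lemma spanning_tree (V : {set T}) (E : {set {set T}}) :
  (0 < #|V|)%N -> connected_pregraph (V, E) ->
  {in E, forall f : {set T}, f \subset V} ->
  exists F, [/\ F \subset E, connected_pregraph (V, F) & #|F|.+1 = #|V|].
Proof.
move=> V0 connV EV.
have mV : (#|V|.-1 < #|V|)%N by rewrite prednK.
have [W [F [WV FE connW _ [cardW cardF]]]] := subtree_of_size connV EV mV.
have WE : W = V by apply/eqP; rewrite eqEcard WV cardW prednK /=.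
by exists F; rewrite cardF prednK // -{1}WE.
Qed.

End SpanningTree.

Section SteinerTrees.
Variables (T : finType) (e : rel T).
Hypothesis e_conn : connected_graph e.
Implicit Types (S : {set T}) (H : pregraph T).

Lemma connects_whole_graph S : connects e S ([set: T], edges e).
Proof.
apply/and3P; split; last exact: subsetT.
  by rewrite /is_subgraph subxx; apply/forall_inP => f _; apply: subsetT.
apply/forall_inP => x _; apply/forall_inP => y _ /=.
apply: connect_sub (e_conn x y) => u v euv; apply: connect1.
by apply/imsetP; exists (u, v); rewrite ?inE.
Qed.

Lemma steiner_div_le S H : connects e S H -> (steiner_div e S <= #|H.2|)%N.
Proof.
move=> SH; rewrite /steiner_div.
by case: arg_minnP => [|K _]; [exact: connects_whole_graph | apply].
Qed.

(** The ratios in the betweenness centrality have a nonzero denominator. *)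
Lemma steiner_trees_gt0 S : (0 < #|steiner_trees e S|)%N.
Proof.
apply/card_gt0P.
exists [arg min_(H < ([set: T], edges e) | connects e S H) #|H.2| ].
rewrite inE eqxx andbT.
by case: arg_minnP => //; exact: connects_whole_graph.
Qed.

(** Nonemptiness of [S] matters: the empty pregraph is a Steiner tree on the
    empty set, with as many vertices as edges. *)
Lemma card_steiner_tree S H :
  (0 < #|S|)%N -> H \in steiner_trees e S -> #|H.1| = (steiner_div e S).+1.
Proof.
case: H => V E /= S0; rewrite inE /= => /andP[/and3P[/andP[/= Ee EV] connV SV]].
move=> /eqP cardE; have V0 := leq_trans S0 (subset_leq_card SV).
have [F [FE connF cardF]] := spanning_tree V0 connV (forall_inP EV).
(* The spanning tree still connects S, so it has at least as many edges as the
   Steiner tree that contains it. *)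
rewrite -cardF; congr _.+1; apply/eqP; rewrite eqn_leq -{1}cardE.
rewrite (subset_leq_card FE) /=; apply: (@steiner_div_le S (V, F)).
rewrite /connects connF SV /is_subgraph (subset_trans FE Ee) /= andbT.
by apply/forall_inP => f /(subsetP FE); apply: forall_inP EV f.
Qed.

(** Double counting of the pairs formed by a Steiner tree and one of its
    non-terminal vertices. *)
Lemma sum_card_through S : (0 < #|S|)%N ->
  (\sum_(v | v \notin S) #|steiner_trees_through e S v| =
   #|steiner_trees e S| * ((steiner_div e S).+1 - #|S|))%N.
Proof.
move=> S0; rewrite -sum_nat_const.
under eq_bigr do rewrite -sum1_card.
rewrite (exchange_big_dep (mem (steiner_trees e S))) /=; last first.
  by move=> v H _; rewrite inE => /andP[].
apply: eq_bigr => H HS.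
rewrite -(card_steiner_tree S0 HS) sum1dep_card -cardsDS; last first.
  by move: HS; rewrite inE => /andP[/and3P[]].
apply: eq_card => v.
by rewrite in_set [H \in _]in_set HS in_setD; case: (v \in S).
Qed.

Lemma sum_through_ratio S : (0 < #|S|)%N ->
  \sum_(v | v \notin S)
    #|steiner_trees_through e S v|%:R / #|steiner_trees e S|%:R =
  (steiner_div e S)%:R + 1 - #|S|%:R :> rat.
Proof.
move=> S0; rewrite -mulr_suml -natr_sum sum_card_through // natrM mulrC mulKf.
  have [H HS] := card_gt0P (steiner_trees_gt0 S).
  (* The subtraction in sum_card_through is not truncated, as a Steiner tree
     contains its terminals. *)
  rewrite natrB ?mulrS 1?addrC //.
  rewrite -(card_steiner_tree S0 HS) subset_leq_card //.
  by move: HS; rewrite inE => /andP[/and3P[]].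
by rewrite pnatr_eq0 -lt0n steiner_trees_gt0.
Qed.

Lemma sum_steiner_betweenness (k : nat) : (0 < k)%N ->
  \sum_(v : T) steiner_betweenness e k v =
  (SW e k)%:R - (k%:R - 1) * 'C(#|T|, k)%:R.
Proof.
move=> k0; rewrite /steiner_betweenness.
rewrite (exchange_big_dep (fun A : {set T} => #|A| == k)) /=; last first.
  by move=> v A _ /andP[].
transitivity (\sum_(A : {set T} | #|A| == k)
                 ((steiner_div e A)%:R - (k%:R - 1) : rat)).
  apply: eq_bigr => A /eqP cardA.
  rewrite opprB addrA -{2}cardA -sum_through_ratio ?cardA //.
  by apply: eq_bigl => v; rewrite eqxx andbT subsetC sub1set inE.
rewrite sumrB -natr_sum sumr_const mulr_natr; congr (_ - _ *+ _).
by rewrite -card_draws cardsE.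
Qed.

End SteinerTrees.

Theorem corollary4 (T : finType) (e : rel T)
  (e_sym : symmetric e) (e_irr : irreflexive e) (e_conn : connected_graph e)
  (n : nat) (card_T : #|T| = n) (k : nat) (k_ge2 : (2 <= k)%N)
  (k_le_n : (k <= n)%N) :
  avgB e k = ('C(n, k))%:R / n%:R * (avgSW e k - k%:R + 1).
Proof.
have C0 : ('C(n, k))%:R != 0 :> rat by rewrite pnatr_eq0 -lt0n bin_gt0.
rewrite /avgB /avgSW sum_steiner_betweenness ?(ltnW k_ge2) // card_T.
rewrite [X in _ = X * _]mulrC -mulrA; congr (_ * _).
rewrite [RHS]mulrC -[_ + 1]addrA [RHS]mulrDl divfK //.
by rewrite -mulNr opprB [1 - _]addrC.
Qed.
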